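(* Let $\lambda\in\mathbb{R}$, let $n,r\in\mathbb{N}$ (positive integers) with $n\ge r$, and let $k_1,\dots,k_r\in\mathbb{Z}$. Then the value of $g_{n,\lambda}^{(k_1,\dots,k_r)}(x)$ at $x=r$ is $$g_{n,\lambda}^{(k_1,\dots,k_r)}(r)=\sum_{m=0}^{n-r}\sum_{l=0}^{r}\;\sum_{0<n_1<n_2<\cdots<n_r\le n-m}\frac{(1)_{n_1,\lambda}\cdots(1)_{n_r,\lambda}\binom{r}{l}\binom{n}{m}(-1)^l2^{r-l}\,\mathcal{E}_{m,\lambda}^{(l)}\,S_{1,\lambda}(n-m,n_r)}{(n_1-1)!\cdots(n_{r-1}-1)!\;n_1^{k_1}\cdots n_{r-1}^{k_{r-1}}\,n_r^{k_r-1}},$$ where the innermost sum is over all integers $n_1,\dots,n_r$ satisfying the indicated inequalities.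
   Context: All generating functions are formal power series in $t$; $x$ is a real variable (or indeterminate). Degenerate falling factorials: $(x)_{0,\lambda}=1$, $(x)_{n,\lambda}=x(x-\lambda)\cdots(x-(n-1)\lambda)$ for $n\ge1$. Ordinary falling factorials: $(x)_0=1$, $(x)_n=x(x-1)\cdots(x-n+1)$ for $n\ge 1$. Degenerate exponentials: $e_\lambda^x(t)=(1+\lambda t)^{x/\lambda}=\sum_{n\ge0}(x)_{n,\lambda}\frac{t^n}{n!}$ and $e_\lambda(t)=e_\lambda^1(t)$. Degenerate logarithm: $\log_\lambda(t)=\frac1\lambda(t^\lambda-1)$, the compositional inverse of $e_\lambda(t)$; thus $\log_\lambda(1+t)=\frac{(1+t)^\lambda-1}{\lambda}$. For $\lambda=0$ these are read as their limits $e^{xt}$, $e^t$ and $\log t$. Degenerate Stirling numbers of the first kind $S_{1,\lambda}(n,l)$: defined by $(x)_n=\sum_{l=0}^nS_{1,\lambda}(n,l)(x)_{l,\lambda}$ for $n\ge0$. Degenerate Euler polynomials of order $l$ (for integers $l\ge0$): $\left(\frac{2}{e_\lambda(t)+1}\right)^le_\lambda^x(t)=\sum_{n\ge0}\mathcal{E}^{(l)}_{n,\lambda}(x)\frac{t^n}{n!}$; and $\mathcal{E}^{(l)}_{n,\lambda}=\mathcal{E}^{(l)}_{n,\lambda}(0)$. Degenerate multiple polyexponential function: for $k_1,\dots,k_r\in\mathbb{Z}$, $$Ei_{k_1,\dots,k_r,\lambda}(x)=\sum_{0<n_1<n_2<\cdots<n_r}\frac{(1)_{n_1,\lambda}\cdots(1)_{n_r,\lambda}\,x^{n_r}}{(n_1-1)!(n_2-1)!\cdots(n_r-1)!\,n_1^{k_1}\cdots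 n_r^{k_r}},$$ the sum being over all integers $n_1,\dots,n_r$ with $0<n_1<\cdots<n_r$. Degenerate multi-poly-Genocchi polynomials $g_{n,\lambda}^{(k_1,\dots,k_r)}(x)$: defined by $$\frac{2^r\,Ei_{k_1,\dots,k_r,\lambda}(\log_\lambda(1+t))}{(e_\lambda(t)+1)^r}\,e_\lambda^x(t)=\sum_{n=0}^\infty g_{n,\lambda}^{(k_1,\dots,k_r)}(x)\frac{t^n}{n!}.$$ Empty products equal $1$. *)

(* Defs.v *)
From HB Require Import structures.
From mathcomp Require Import all_boot all_order all_algebra.
From mathcomp Require Import boolp reals ring.

Set Implicit Arguments.
Unset Strict Implicit.
Unset Printing Implicit Defensive.

Import Order.TTheory GRing.Theory Num.Theory.
Local Open Scope ring_scope.

(* Formal power series in one indeterminate, represented by their coefficients.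
   They are wrapped in a record so that the product below is not confused with
   the pointwise product of functions. *)
Record fps (R : Type) := Fps { fcoef : nat -> R }.

Lemma fpsP (R : Type) (f g : fps R) : (forall n, fcoef f n = fcoef g n) -> f = g.
Proof. by case: f g => [f] [g] /= fg; congr Fps; apply: funext. Qed.

HB.instance Definition _ (R : Type) := gen_eqMixin (fps R).
HB.instance Definition _ (R : Type) := gen_choiceMixin (fps R).

Section FpsZmod.
Variable R : zmodType.
Implicit Types f g h : fps R.

Definition fps_zero : fps R := Fps (fun=> 0).
Definition fps_opp f : fps R := Fps (fun n => - fcoef f n).
Definition fps_add f g : fps R := Fps (fun n => fcoef f n + fcoef g n).

Fact fps_addA : associative fps_add.
Proof. by move=> f g h; apply: fpsP => n /=; rewrite addrA. Qed.
Fact fps_addC : commutative fps_add.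
Proof. by move=> f g; apply: fpsP => n /=; rewrite addrC. Qed.
Fact fps_add0 : left_id fps_zero fps_add.
Proof. by move=> f; apply: fpsP => n /=; rewrite add0r. Qed.
Fact fps_addN : left_inverse fps_zero fps_opp fps_add.
Proof. by move=> f; apply: fpsP => n /=; rewrite addNr. Qed.

HB.instance Definition _ :=
  GRing.isZmodule.Build (fps R) fps_addA fps_addC fps_add0 fps_addN.

Lemma fcoef0 n : fcoef (0 : fps R) n = 0. Proof. by []. Qed.
Lemma fcoefD f g n : fcoef (f + g) n = fcoef f n + fcoef g n. Proof. by []. Qed.
Lemma fcoefN f n : fcoef (- f) n = - fcoef f n. Proof. by []. Qed.
Lemma fcoefB f g n : fcoef (f - g) n = fcoef f n - fcoef g n. Proof. by []. Qed.
Lemma fcoef_sum I (s : seq I) (P : pred I) (F : I -> fps R) n :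
  fcoef (\sum_(i <- s | P i) F i) n = \sum_(i <- s | P i) fcoef (F i) n.
Proof. by elim/big_ind2: _ => // f x g y <- <-. Qed.
End FpsZmod.

Section FpsRing.
Variable R : comNzRingType.
Implicit Types f g h : fps R.

Definition fps_one : fps R := Fps (fun n => (n == 0%N)%:R).
Definition fps_mul f g : fps R :=
  Fps (fun n => \sum_(i < n.+1) fcoef f i * fcoef g (n - i)).

Definition fps_trunc n f : {poly R} := \poly_(i < n.+1) fcoef f i.

Fact coef_fps_trunc n f i : (i <= n)%N -> (fps_trunc n f)`_i = fcoef f i.
Proof. by move=> le_in; rewrite coef_poly ltnS le_in. Qed.

Fact coef_fps_mul n f g (p q : {poly R}) i :
    (forall j, (j <= n)%N -> p`_j = fcoef f j) ->
    (forall j, (j <= n)%N -> q`_j = fcoef g j) ->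
  (i <= n)%N -> (p * q)`_i = fcoef (fps_mul f g) i.
Proof.
move=> pf qg le_in; rewrite coefM /=; apply: eq_bigr => j _.
rewrite pf ?qg //; first exact: leq_trans (leq_subr _ _) le_in.
by apply: leq_trans le_in; rewrite -ltnS.
Qed.

Fact fps_mulA : associative fps_mul.
Proof.
move=> f g h; apply: fpsP => n.
have T := @coef_fps_trunc n.
have TM f' g' j (le_jn : (j <= n)%N) := coef_fps_mul (T f') (T g') le_jn.
rewrite -(coef_fps_mul (T f) (TM g h) (leqnn n)).
by rewrite -(coef_fps_mul (TM f g) (T h) (leqnn n)) mulrA.
Qed.

Fact fps_mulC : commutative fps_mul.
Proof.
move=> f g; apply: fpsP => n; have T := @coef_fps_trunc n.
by rewrite -(coef_fps_mul (T f) (T g) (leqnn n)) mulrC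
  (coef_fps_mul (T g) (T f)).
Qed.

Fact fps_mul1 : left_id fps_one fps_mul.
Proof.
move=> f; apply: fpsP => n /=; rewrite big_ord_recl subn0 mul1r big1 ?addr0 //.
by move=> i _; rewrite mul0r.
Qed.

Fact fps_mulDl : left_distributive fps_mul +%R.
Proof.
move=> f g h; apply: fpsP => n /=; rewrite -big_split /=.
by apply: eq_bigr => i _; rewrite mulrDl.
Qed.

Fact fps_one_neq0 : fps_one != 0.
Proof.
by apply/eqP => /(congr1 (fun f => fcoef f 0)) /eqP; rewrite /= oner_eq0.
Qed.

HB.instance Definition _ := GRing.Zmodule_isComNzRing.Build (fps R)
  fps_mulA fps_mulC fps_mul1 fps_mulDl fps_one_neq0.

Lemma fcoef1 n : fcoef (1 : fps R) n = (n == 0%N)%:R. Proof. by []. Qed.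
Lemma fcoefM f g n :
  fcoef (f * g) n = \sum_(i < n.+1) fcoef f i * fcoef g (n - i).
Proof. by []. Qed.

Definition fps_scale (a : R) f : fps R := Fps (fun n => a * fcoef f n).

Fact fps_scaleA a b f : fps_scale a (fps_scale b f) = fps_scale (a * b) f.
Proof. by apply: fpsP => n /=; rewrite mulrA. Qed.
Fact fps_scale1 : left_id 1 fps_scale.
Proof. by move=> f; apply: fpsP => n /=; rewrite mul1r. Qed.
Fact fps_scaleDr : right_distributive fps_scale +%R.
Proof. by move=> a f g; apply: fpsP => n /=; rewrite mulrDr. Qed.
Fact fps_scaleDl f : {morph fps_scale^~ f : a b / a + b}.
Proof. by move=> a b; apply: fpsP => n /=; rewrite mulrDl. Qed.

HB.instance Definition _ := GRing.Zmodule_isLmodule.Build R (fps R)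
  fps_scaleA fps_scale1 fps_scaleDr fps_scaleDl.

Lemma fcoefZ a f n : fcoef (a *: f) n = a * fcoef f n. Proof. by []. Qed.

(* f(g(t)); only meaningful when g has zero constant term, in which case the
   coefficient of t^n in f_j g(t)^j vanishes for j > n. *)
Definition fps_comp f g : fps R :=
  Fps (fun n => \sum_(j < n.+1) fcoef f j * fcoef (g ^+ j) n).

Lemma fcoefX_lt f j n : fcoef f 0 = 0 -> (n < j)%N -> fcoef (f ^+ j) n = 0.
Proof.
move=> f0; elim: j n => // j IHj n lt_nj; rewrite exprS fcoefM big_ord_recl /=.
rewrite f0 mul0r add0r big1 // => i _; rewrite IHj ?mulr0 // /bump /= add1n.
by rewrite ltnS in lt_nj; apply: leq_trans lt_nj; rewrite ltn_subrL /= (leq_ltn_trans _ (ltn_ord i)).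
Qed.

Lemma fps_compE f g n N : fcoef g 0 = 0 -> (n <= N)%N ->
  fcoef (fps_comp f g) n = \sum_(j < N.+1) fcoef f j * fcoef (g ^+ j) n.
Proof.
move=> g0 le_nN; rewrite /= (big_ord_widen N.+1
  (fun j => fcoef f j * fcoef (g ^+ j) n)) // big_mkcond /=.
apply: eq_bigr => j _; case: ltnP => // lt_nj.
by rewrite fcoefX_lt ?mulr0.
Qed.
End FpsRing.

Section FpsUnit.
Variable F : fieldType.
Implicit Types f g h : fps F.

Definition fps_unit : {pred fps F} := fun f => fcoef f 0 != 0.

(* With a = f(0), 1/f = a^-1 * 1/(1 - u) where u = 1 - a^-1 f has u(0) = 0. *)
Definition fps_inv f : fps F :=
  if fcoef f 0 != 0 then
    (fcoef f 0)^-1 *: fps_comp (Fps (fun=> 1)) (1 - (fcoef f 0)^-1 *: f)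
  else f.

Fact fps_mulVx : {in fps_unit, left_inverse 1 fps_inv *%R}.
Proof.
move=> f uf; have f0 : fcoef f 0 != 0 by [].
rewrite /fps_inv f0; set a := fcoef f 0; set u := 1 - a^-1 *: f.
have u0 : fcoef u 0 = 0 by rewrite fcoefB fcoefZ fcoef1 mulVf ?subrr.
apply: fpsP => n; pose G : fps F := \sum_(j < n.+1) u ^+ j.
have fE : f = a *: (1 - u).
  by rewrite /u opprB addrC subrK scalerA mulfV ?scale1r.
have sM b (g h : fps F) : (b *: g) * h = b *: (g * h).
  apply: fpsP => m; rewrite fcoefZ !fcoefM mulr_sumr; apply: eq_bigr => i _.
  by rewrite fcoefZ mulrA.
have E : (1 - u) * G = 1 - u ^+ n.+1.
  by rewrite /G -{2}(expr1n (fps F) n.+1) subrXX;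
    congr (_ * _); apply: eq_bigr => i _; rewrite expr1n mul1r.
transitivity (fcoef (a^-1 *: (G * f)) n).
  rewrite sM !fcoefZ !fcoefM; congr (_ * _); apply: eq_bigr => i _.
  have le_in : (i <= n)%N by rewrite -ltnS.
  rewrite (fps_compE _ u0 le_in) /G fcoef_sum; congr (_ * _).
  by apply: eq_bigr => j _ /=; rewrite mul1r.
rewrite mulrC fE sM E scalerA mulVf // scale1r fcoefB fcoefX_lt //.
by rewrite subr0.
Qed.

Fact fps_unitPl f g : g * f = 1 -> fps_unit f.
Proof.
move=> /(congr1 (fun h => fcoef h 0)); rewrite fcoefM big_ord1 fcoef1 /= => fg.
by apply/eqP => f0; move/eqP: fg; rewrite f0 mulr0 eq_sym oner_eq0.
Qed.

Fact fps_invr_out : {in [predC fps_unit], fps_inv =1 id}.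
Proof.
by move=> f; rewrite inE /= -topredE /= /fps_unit /fps_inv => /negbTE ->.
Qed.

HB.instance Definition _ := GRing.ComNzRing_hasMulInverse.Build (fps F)
  fps_mulVx fps_unitPl fps_invr_out.

Lemma fps_unitE f : (f \is a GRing.unit) = (fcoef f 0 != 0).
Proof. by []. Qed.
End FpsUnit.

Section Degenerate.
Variable R : realType.
Implicit Types (lambda x : R) (n l r : nat).

Definition falling x n : R := \prod_(i < n) (x - i%:R).
Definition dfalling lambda x n : R := \prod_(i < n) (x - i%:R * lambda).

(* e_lambda^x(t); for lambda = 0 this is exp(xt). *)
Definition dexp lambda x : fps R := Fps (fun n => dfalling lambda x n / n`!%:R).

(* (1 + t)^a *)
Definition binomial_fps (a : R) : fps R := Fps (fun n => falling a n / n`!%:R).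

(* log (1 + t) *)
Definition log1p_fps : fps R :=
  Fps (fun n => if n == 0%N then 0 else (-1) ^+ n.-1 / n%:R).

(* log_lambda (1 + t) *)
Definition dlog1p lambda : fps R :=
  if lambda == 0 then log1p_fps else lambda^-1 *: (binomial_fps lambda - 1).

Definition dstirling1_spec lambda (S : nat -> nat -> R) : Prop :=
  forall n x, falling x n = \sum_(l < n.+1) S n l * dfalling lambda x l.

Lemma dstirling1_exists lambda : exists S, dstirling1_spec lambda S.
Proof.
suff /choice[S SP] : forall n, exists c : nat -> R, forall x,
  falling x n = \sum_(l < n.+1) c l * dfalling lambda x l by exists S.
elim=> [|n [c cP]].
  by exists (fun=> 1) => x; rewrite big_ord1 /falling /dfalling !big_ord0 mulr1.
exists (fun l => (if l is l'.+1 then c l' else 0) +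
                 (if (l <= n)%N then c l * (l%:R * lambda - n%:R) else 0)) => x.
have -> : falling x n.+1 = falling x n * (x - n%:R) by rewrite /falling big_ord_recr.
rewrite cP mulr_suml.
under [RHS]eq_bigr do rewrite mulrDl.
rewrite big_split /= [X in _ = X + _]big_ord_recl /= mul0r add0r.
rewrite [X in _ = _ + X]big_ord_recr /= ltnn mul0r addr0 -big_split /=; apply: eq_bigr => i _.
rewrite -ltnS ltn_ord /bump /= add1n.
have -> : dfalling lambda x i.+1 = dfalling lambda x i * (x - i%:R * lambda).
  by rewrite /dfalling big_ord_recr.
by ring.
Qed.

Lemma dstirling1_uniq lambda S S' n l :
    dstirling1_spec lambda S -> dstirling1_spec lambda S' ->
  (l <= n)%N -> S n l = S' n l.
Proof.
move=> /(_ n) SP /(_ n) SP'.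
have {SP SP'} : forall x,
    \sum_(l < n.+1) (S n l - S' n l) * dfalling lambda x l = 0.
  move=> x; under eq_bigr do rewrite mulrBl.
  by rewrite sumrB -SP -SP' subrr.
move: (S n) (S' n) l => c c'; elim: n => [|n IHn] l sum0.
  rewrite leqn0 => /eqP->; apply/eqP; rewrite -subr_eq0; apply/eqP.
  by have := sum0 0; rewrite big_ord1 /dfalling big_ord0 mulr1.
pose d m : {poly R} := \prod_(i < m) ('X - (i%:R * lambda)%:P).
have dE m x : (d m).[x] = dfalling lambda x m.
  by rewrite horner_prod; apply: eq_bigr => i _; rewrite hornerXsubC.
have sd m : size (d m) = m.+1.
  by rewrite /d -(big_enum _ _ _ _) size_prod_XsubC size_enum_ord.
pose p := \sum_(l < n.+2) (c l - c' l) *: d l.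
have p0 : p = 0.
  apply: contra_eq (isT) => pn0; have rts := max_poly_roots pn0.
  have /rts : all (root p) [seq i%:R | i <- iota 0 (size p)].
    apply/allP => _ /mapP[i _ ->]; rewrite /root horner_sum; apply/eqP.
    by rewrite -[RHS](sum0 i%:R); apply: eq_bigr => j _; rewrite hornerZ dE.
  rewrite size_map size_iota ltnn; apply.
  by rewrite map_inj_uniq ?iota_uniq //; apply: mulrIn; rewrite oner_eq0.
have top : c n.+1 = c' n.+1.
  have := congr1 (fun q : {poly R} => q`_n.+1) p0.
  rewrite coef0 coef_sum big_ord_recr /= big1 => [|i _]; last first.
    by rewrite coefZ nth_default ?mulr0 ?sd.
  have /eqP lc : lead_coef (d n.+1) == 1 by apply: monic_prod => i _; exact: monicXsubC.
  move: lc; rewrite lead_coefE sd /= add0r coefZ => ->; rewrite mulr1 => /eqP.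
  by rewrite subr_eq0 => /eqP.
rewrite leq_eqVlt => /predU1P[-> //|]; rewrite ltnS; apply: IHn => x.
by rewrite -[RHS](sum0 x) [in RHS]big_ord_recr /= top subrr mul0r addr0.
Qed.

(* S_{1,lambda}(n, l); its values for l > n are unspecified. *)
Definition dstirling1 lambda : nat -> nat -> R :=
  sval (cid (dstirling1_exists lambda)).

Lemma dstirling1P lambda : dstirling1_spec lambda (dstirling1 lambda).
Proof. exact: svalP. Qed.

Definition deuler lambda l n x : R :=
  n`!%:R * fcoef ((2%:R / (dexp lambda 1 + 1)) ^+ l * dexp lambda x) n.

(* A summation index n_1 < ... < n_r <= N is an r-tuple over 'I_N.+1;
   [ent ns i] is n_{i+1}, so that n_r is [ent ns r.-1]. *)
Definition ent r N (ns : r.-tuple 'I_N.+1) (i : nat) : nat :=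
  nth 0%N (map val ns) i.

(* 0 < n_1 < ... < n_r *)
Definition chain r N (ns : r.-tuple 'I_N.+1) : bool := path ltn 0%N (map val ns).

(* Coefficient of x^N in Ei_{k_1,...,k_r,lambda}(x), for r > 0: the (finite) sum
   over the chains with n_r = N. *)
Definition dEi lambda r (k : r.-tuple int) : fps R :=
  Fps (fun N =>
    \sum_(ns : r.-tuple 'I_N.+1 | chain ns && (ent ns r.-1 == N))
      (\prod_(i < r) dfalling lambda 1 (ent ns i)) /
      ((\prod_(i < r) ((ent ns i).-1)`!%:R) *
       (\prod_(i < r) (ent ns i)%:R ^ tnth k i))).

Definition dgenocchi lambda r (k : r.-tuple int) n x : R :=
  n`!%:R * fcoef ((2%:R ^+ r * fps_comp (dEi lambda k) (dlog1p lambda))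
                  / (dexp lambda 1 + 1) ^+ r * dexp lambda x) n.

End Degenerate.

(* Main.v *)
Require Import Defs.
From mathcomp Require Import all_boot all_order all_algebra.
From mathcomp Require Import reals ring.

(** The point x = r is special because the degenerate exponential is
multiplicative in its exponent ([dexpD]): the factor e_lambda^r(t) is
e_lambda(t)^r, so with u = 2 / (e_lambda(t) + 1) the generating function is
<<
  (2 e_lambda(t) / (e_lambda(t) + 1))^r * Ei(log_lambda(1+t))
    = (2 - u)^r * Ei(log_lambda(1+t)).
>>
The binomial theorem expands the first factor in powers u^l, whose
coefficients are the Euler numbers of order l ([fcoef_euler_kernel_power]).
In the second factor, a chain ending in N contributes a multiple of the N-th
power of log_lambda(1+t), and
<<
  log_lambda(1+t)^N / N! = sum_(n >= N) S_(1,lambda)(n, N) t^n / n!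
>>
([dlog1p_stirling1]); the N! cancels (N-1)! and lowers the exponent of N by
one ([chain_weight_fact]). The theorem is the Cauchy product of the two
expansions; it stops at m = n - r since a chain of r positive integers ends at
r or later.

The degenerate series are handled through first-order differential equations
in which lambda is never inverted; only the proof of [dlog1p_ode] treats
lambda = 0 separately. With
L = log_lambda(1+t) one has (1+t) L' = 1 + lambda L, hence
<<
  (1+t) (L^N)' = N L^(N-1) + lambda N L^N;
>>
read on coefficients, this is the recurrence that the identity
(x)_(n+1) = (x)_n (x - n) imposes on the Stirling numbers. *)

Set Implicit Arguments.
Unset Strict Implicit.
Unset Printing Implicit Defensive.

Import GRing.Theory Num.Theory.
Local Open Scope ring_scope.

(** * The Euler operator t d/dt on formal power series *)

Section FormalCalculus.
Variable R : comNzRingType.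
Implicit Types (f g : fps R) (a c : R).

Definition fps_var : fps R := Fps (fun n => (n == 1%N)%:R).

(** The operator t d/dt: unlike d/dt it preserves the index of a coefficient,
    which makes the Leibniz rule a termwise identity. *)
Definition fps_theta f : fps R := Fps (fun n => n%:R * fcoef f n).

Lemma fcoefVarM0 f : fcoef (fps_var * f) 0 = 0.
Proof. by rewrite fcoefM big_ord1 mul0r. Qed.

Lemma fcoefVarMS f n : fcoef (fps_var * f) n.+1 = fcoef f n.
Proof.
rewrite fcoefM big_ord_recl big_ord_recl /= mul0r add0r mul1r subSS subn0.
by rewrite big1 ?addr0 // => i _; rewrite mul0r.
Qed.

Lemma fps_scaleAl a f g : a *: (f * g) = a *: f * g.
Proof.
apply: fpsP => n; rewrite fcoefZ !fcoefM mulr_sumr.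
by apply: eq_bigr => i _; rewrite fcoefZ mulrA.
Qed.

Lemma fps_scaleAr a f g : a *: (f * g) = f * (a *: g).
Proof. by rewrite mulrC fps_scaleAl mulrC. Qed.

Lemma fcoefMn f m n : fcoef (f *+ m) n = fcoef f n *+ m.
Proof. by elim: m => // m IHm; rewrite !mulrS fcoefD IHm. Qed.

Lemma fps_thetaM f g :
  fps_theta (f * g) = fps_theta f * g + f * fps_theta g.
Proof.
apply: fpsP => n; rewrite fcoefD /fps_theta fcoefM [fcoef _ n]/= mulr_sumr.
rewrite -big_split; apply: eq_bigr => i _ /=.
have {1}-> : n = (i + (n - i))%N by rewrite subnKC // -ltnS.
by rewrite natrD; ring.
Qed.

Lemma fps_thetaX f N :
  fps_theta (f ^+ N) = N%:R * f ^+ N.-1 * fps_theta f.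
Proof.
elim: N => [|N IHN].
  rewrite !mul0r expr0; apply: fpsP => n; rewrite fcoef0 /=.
  by case: n => [|n]; rewrite ?mul0r ?mulr0.
rewrite exprS fps_thetaM IHN; case: N {IHN} => [|N] /=; first by ring.
by rewrite !exprS; ring.
Qed.

Lemma fcoef_theta_ode c f n :
  fcoef ((1 + c *: fps_var) * fps_theta f) n.+1
  = n.+1%:R * fcoef f n.+1 + c * (n%:R * fcoef f n).
Proof.
by rewrite mulrDl mul1r fcoefD -fps_scaleAl fcoefZ fcoefVarMS.
Qed.

End FormalCalculus.

Arguments fps_var {R}.

(** * Differential equations of the degenerate exponential and logarithm *)

Section Series.
Variable R : realType.
Implicit Types (lambda x y : R) (f g : fps R).

Lemma natr_fact_neq0 n : n`!%:R != 0 :> R.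
Proof. by rewrite pnatr_eq0 -lt0n fact_gt0. Qed.

Lemma dfallingS lambda x n :
  dfalling lambda x n.+1 = dfalling lambda x n * (x - n%:R * lambda).
Proof. by rewrite /dfalling big_ord_recr. Qed.

Lemma fallingS x n : falling x n.+1 = falling x n * (x - n%:R).
Proof. by rewrite /falling big_ord_recr. Qed.

Lemma dexp_coef0 lambda x : fcoef (dexp lambda x) 0 = 1.
Proof. by rewrite /= /dfalling big_ord0 divr1. Qed.

(** This is (1 + lambda t) f' = x f, multiplied by t. *)
Lemma dexp_ode lambda x :
  (1 + lambda *: fps_var) * fps_theta (dexp lambda x)
  = x *: (fps_var * dexp lambda x).
Proof.
apply: fpsP => -[|n].
  by rewrite fcoefM big_ord1 fcoefZ fcoefVarM0 /= mul0r !mulr0.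
rewrite fcoef_theta_ode fcoefZ fcoefVarMS /= dfallingS factS natrM.
have := natr_fact_neq0 n; have : n.+1%:R != 0 :> R by rewrite pnatr_eq0.
by move=> ? ?; field; rewrite nat1r; apply/andP.
Qed.

Lemma dexp_uniq lambda x f :
    fcoef f 0 = 1 ->
    (1 + lambda *: fps_var) * fps_theta f = x *: (fps_var * f) ->
  f = dexp lambda x.
Proof.
move=> f0 ode; apply: fpsP; elim=> [|n IHn]; first by rewrite dexp_coef0.
apply: (@mulfI _ n.+1%:R); first by rewrite pnatr_eq0.
have := congr1 (fun h => fcoef h n.+1) (dexp_ode lambda x).
have := congr1 (fun h => fcoef h n.+1) ode.
rewrite !fcoef_theta_ode !fcoefZ !fcoefVarMS IHn => <-.
by move/addIr.
Qed.

(** Both sides start with 1 and solve (1 + lambda t) f' = (x + y) f, an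
    equation that determines every further coefficient. *)
Lemma dexpD lambda x y :
  dexp lambda (x + y) = dexp lambda x * dexp lambda y.
Proof.
apply/esym/dexp_uniq; first by rewrite fcoefM big_ord1 !dexp_coef0 mulr1.
rewrite fps_thetaM mulrDr mulrA dexp_ode mulrCA dexp_ode scalerDl.
by rewrite -fps_scaleAl -fps_scaleAr; congr (_ *: _ + _ *: _); ring.
Qed.

Lemma dexp0 lambda : dexp lambda 0 = 1.
Proof.
apply/esym/dexp_uniq => //; rewrite scale0r.
apply: fpsP => n; rewrite fcoefM big1 // => i _ /=.
by case: (n - i)%N => [|j]; rewrite /= ?mul0r !mulr0.
Qed.

Lemma dexp_nat lambda r : dexp lambda r%:R = dexp lambda 1 ^+ r.
Proof.
by elim: r => [|r IHr]; rewrite ?dexp0 // -natr1 dexpD IHr exprSr.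
Qed.

Lemma binomial_fpsE x : binomial_fps x = dexp 1 x.
Proof.
by apply: fpsP => n /=; congr (_ / _);
  apply: eq_bigr => i _; rewrite mulr1.
Qed.

Lemma dlog1p_coef0 lambda : fcoef (dlog1p lambda) 0 = 0.
Proof.
rewrite /dlog1p; case: ifP => // _.
by rewrite fcoefZ fcoefB binomial_fpsE dexp_coef0 subrr mulr0.
Qed.

(** This is (1 + t) L' = 1 + lambda L, multiplied by t: for nonzero lambda,
    both sides are (1 + t)^lambda. *)
Lemma dlog1p_ode lambda :
  (1 + fps_var) * fps_theta (dlog1p lambda)
  = fps_var * (1 + lambda *: dlog1p lambda).
Proof.
rewrite -{1}[fps_var]scale1r /dlog1p; case: eqP => [->|/eqP lam_neq0].
  apply: fpsP => -[|n].
    by rewrite fcoefM big_ord1 fcoefVarM0 /= mul0r mulr0.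
  rewrite fcoef_theta_ode scale0r addr0 fcoefVarMS /=.
  have n1 : n.+1%:R != 0 :> R by rewrite pnatr_eq0.
  rewrite mulrCA mulfV // mulr1 mul1r.
  case: n n1 => [|n] n1 /=; first by ring.
  have n1' : n.+1%:R != 0 :> R by rewrite pnatr_eq0.
  by rewrite mulrCA mulfV // mulr1 exprS; ring.
have -> : fps_theta (lambda^-1 *: (binomial_fps lambda - 1))
    = lambda^-1 *: fps_theta (dexp 1 lambda).
  apply: fpsP => n; rewrite -binomial_fpsE fcoefZ [LHS]/= mulrCA; congr (_ * _).
  rewrite /=; case: n => [|n] /=; ring.
rewrite -fps_scaleAr dexp_ode !scalerA mulVf // mulfV //.
by rewrite !scale1r binomial_fpsE addrC subrK.
Qed.

Lemma dlog1pX_coef lambda N n :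
  n.+1%:R * fcoef (dlog1p lambda ^+ N) n.+1
  = N%:R * fcoef (dlog1p lambda ^+ N.-1) n
    + (N%:R * lambda - n%:R) * fcoef (dlog1p lambda ^+ N) n.
Proof.
have ode : (1 + 1 *: fps_var) * fps_theta (dlog1p lambda ^+ N)
    = fps_var * ((dlog1p lambda ^+ N.-1 + lambda *: dlog1p lambda ^+ N) *+ N).
  rewrite scale1r fps_thetaX mulrCA dlog1p_ode; case: N => [|N] /=.
    by rewrite !mul0r mulr0n mulr0.
  by rewrite exprS fps_scaleAl -[X in _ = _ * X]mulr_natl; ring.
have := congr1 (fun h => fcoef h n.+1) ode.
rewrite fcoef_theta_ode fcoefVarMS fcoefMn fcoefD fcoefZ mul1r.
rewrite -[X in _ = X]mulr_natl => E.
by move/(canRL (addrK _)): E => ->; ring.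
Qed.

(** The coefficients n! [t^n] L^l / l! satisfy the recurrence
    T(n+1, l+1) = T(n, l) + ((l+1) lambda - n) T(n, l+1), which is what
    multiplying sum_l T(n, l) (x)_(l,lambda) by
    x - n = (x - l lambda) + (l lambda - n) produces. *)
Lemma dlog1p_stirling1 lambda :
  dstirling1_spec lambda
    (fun n l => n`!%:R / l`!%:R * fcoef (dlog1p lambda ^+ l) n).
Proof.
set T := fun n l => _.
have TS0 n : T n.+1 0%N = - n%:R * T n 0%N.
  rewrite /T !expr0 !fcoef1; case: n => [|n] /=; ring.
have TSS n l : T n.+1 l.+1 = T n l + (l.+1%:R * lambda - n%:R) * T n l.+1.
  have E := dlog1pX_coef lambda l.+1 n; rewrite /= in E.
  have l1 : l.+1%:R != 0 :> R by rewrite pnatr_eq0.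
  have l0 := natr_fact_neq0 l.
  transitivity (n`!%:R / (l.+1%:R * l`!%:R)
      * (n.+1%:R * fcoef (dlog1p lambda ^+ l.+1) n.+1)).
    by rewrite /T !factS !natrM; ring.
  rewrite E /T factS natrM; field.
  by rewrite l0 nat1r.
elim=> [|n IHn] x.
  by rewrite big_ord1 /T /falling /dfalling !big_ord0 fcoef1 divr1 !mulr1.
rewrite fallingS IHn mulr_suml.
have Tlt : T n n.+1 = 0 by rewrite /T fcoefX_lt ?mulr0 // dlog1p_coef0.
transitivity (\sum_(l < n.+1) T n l * dfalling lambda x l.+1
   + \sum_(l < n.+2) (l%:R * lambda - n%:R) * (T n l * dfalling lambda x l)).
  rewrite [X in _ = _ + X]big_ord_recr /= Tlt mul0r mulr0 addr0 -big_split /=.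
  by apply: eq_bigr => l _; rewrite dfallingS; ring.
rewrite [X in _ + X]big_ord_recl [RHS]big_ord_recl /= addrCA -big_split /=.
congr (_ + _); first by rewrite TS0; ring.
by apply: eq_bigr => l _; rewrite /bump /= !add1n TSS; ring.
Qed.

End Series.

(** * Chains of summation indices *)

Section Chains.
Variable R : realType.
Implicit Types (lambda : R).

Lemma ent_ltn r N (ns : r.-tuple 'I_N.+1) i : (ent ns i < N.+1)%N.
Proof.
rewrite /ent; have [le_ri|lt_ir] := leqP r i.
  by rewrite nth_default // size_map size_tuple.
rewrite (nth_map ord0) ?size_tuple //; exact: ltn_ord.
Qed.

Lemma chain_ltn r N (ns : r.-tuple 'I_N.+1) i j :
  chain ns -> (i < j < r)%N -> (ent ns i < ent ns j)%N.
Proof.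
move=> /path_sorted /(sorted_ltn_nth ltn_trans 0%N) inc /andP[lt_ij lt_jr].
rewrite /ent; apply: (inc i j) => //; rewrite inE size_map size_tuple //.
exact: ltn_trans lt_jr.
Qed.

(** With i = r - 1: chains of length r end at r or later, so that none fit
    below r. *)
Lemma chain_gt r N (ns : r.-tuple 'I_N.+1) i :
  chain ns -> (i < r)%N -> (i < ent ns i)%N.
Proof.
move=> chn; elim: i => [|i IHi] lt_ir; last first.
  apply: leq_ltn_trans (IHi (ltnW lt_ir)) _.
  by apply: chain_ltn => //; rewrite leqnn.
move: chn; rewrite /chain /ent.
case: r ns lt_ir => // r ns _; have := size_tuple ns.
by case: (tval ns) => //= a s _ /andP[].
Qed.

Definition chain_weight lambda r (k : r.-tuple int) N (ns : r.-tuple 'I_N.+1) : R :=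
  (\prod_(i < r) dfalling lambda 1 (ent ns i)) /
  ((\prod_(i < r) ((ent ns i).-1)`!%:R) *
   (\prod_(i < r) (ent ns i)%:R ^ tnth k i)).

(** A chain that ends at N has all its entries at most N, so the type of
    indices may be enlarged. This brings the chains with different last entries
    into one index type; [F] takes the entries as a function on nat so that it
    can be evaluated on both. *)
Lemma sum_chain_last r N M (F : (nat -> nat) -> R) : (0 < r)%N -> (N <= M)%N ->
  \sum_(ns : r.-tuple 'I_N.+1 | chain ns && (ent ns r.-1 == N)) F (ent ns)
  = \sum_(ns : r.-tuple 'I_M.+1 | chain ns && (ent ns r.-1 == N)) F (ent ns).
Proof.
move=> r_gt0 le_NM.
pose w (ns : r.-tuple 'I_N.+1) : r.-tuple 'I_M.+1 :=
  map_tuple (widen_ord (le_NM : (N.+1 <= M.+1)%N)) ns.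
pose w' (ns : r.-tuple 'I_M.+1) : r.-tuple 'I_N.+1 :=
  map_tuple (fun i : 'I_M.+1 => inord i) ns.
have valw ns : map val (w ns) = map val ns by rewrite -map_comp; apply: eq_map.
rewrite [RHS](reindex_onto w w') => [|ns /andP[chn /eqP ns_last]].
  apply: eq_big => [ns|ns _]; last by rewrite /ent valw.
  rewrite /chain /ent valw -[LHS]andbT; congr (_ && _); apply/esym/eqP.
  apply: val_inj; rewrite /= -map_comp map_id_in // => i _.
  by apply: val_inj; rewrite /= inordK.
apply: val_inj; rewrite /= -map_comp map_id_in // => a /(nthP ord0)[i].
rewrite size_tuple => lt_ir def_a; apply: val_inj; rewrite /= inordK // ltnS.
have -> : a = ent ns i :> nat by rewrite /ent (nth_map ord0) ?size_tuple // def_a.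
rewrite -ns_last; have [-> //|ne] := eqVneq i r.-1.
apply/ltnW/chain_ltn => //; rewrite prednK // leqnn andbT.
by rewrite ltn_neqAle ne -ltnS prednK // lt_ir.
Qed.

(** The composition sorts the chains by their last entry, the power of f that
    they multiply. *)
Lemma fps_comp_dEi lambda r (k : r.-tuple int) (f : fps R) M : (0 < r)%N ->
  fcoef (fps_comp (dEi lambda k) f) M
  = \sum_(ns : r.-tuple 'I_M.+1 | chain ns)
      chain_weight lambda k ns * fcoef (f ^+ ent ns r.-1) M.
Proof.
move=> r_gt0 /=.
rewrite [RHS](partition_big (fun ns => Ordinal (ent_ltn ns r.-1)) predT) //=.
apply: eq_bigr => N _; rewrite mulr_suml.
have le_NM : (N <= M)%N by rewrite -ltnS.
pose F (u : nat -> nat) : R := (\prod_(i < r) dfalling lambda 1 (u i)) /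
  ((\prod_(i < r) ((u i).-1)`!%:R) * (\prod_(i < r) (u i)%:R ^ tnth k i))
  * fcoef (f ^+ u r.-1) M.
transitivity (\sum_(ns : r.-tuple 'I_N.+1 | chain ns && (ent ns r.-1 == N))
                F (ent ns)).
  by apply: eq_bigr => ns /andP[_ /eqP def_N]; rewrite /F def_N.
by rewrite (sum_chain_last F r_gt0 le_NM).
Qed.

End Chains.

(** * The Euler factor and the coefficient identity *)

Section Final.
Variable R : realType.
Implicit Types (lambda : R).

(** Since 2 e / (e + 1) = 2 - 2 / (e + 1), this is the binomial theorem. *)
Lemma euler_kernel_power lambda r :
  2%:R ^+ r * dexp lambda r%:R / (dexp lambda 1 + 1) ^+ r
  = \sum_(l < r.+1)
      ((-1) ^+ l * 2%:R ^+ (r - l) * (2%:R / (dexp lambda 1 + 1)) ^+ l)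
      *+ 'C(r, l).
Proof.
have unit_e : dexp lambda 1 + 1 \is a GRing.unit.
  by rewrite fps_unitE fcoefD dexp_coef0 fcoef1 /= -(natrD _ 1 1) pnatr_eq0.
rewrite dexp_nat -exprVn -!exprMn.
have -> : 2%:R * dexp lambda 1 / (dexp lambda 1 + 1)
    = 2%:R - 2%:R / (dexp lambda 1 + 1).
  by apply: (mulIr unit_e); rewrite mulrBl !mulrVK //; ring.
rewrite exprDn; apply: eq_bigr => l _; congr (_ *+ _).
by rewrite [(- (_ / _)) ^+ l]exprNn; ring.
Qed.

Lemma fcoef_signed_pow2 (f : fps R) l a m :
  fcoef ((-1) ^+ l * 2%:R ^+ a * f) m = (-1) ^+ l * 2%:R ^+ a * fcoef f m.
Proof.
rewrite -natrX -!mulrA mulr_natl -signr_odd.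
rewrite -[in RHS](signr_odd R) -natrX mulr_natl -fcoefMn.
by case: (odd l); rewrite ?expr0 ?expr1 ?mul1r ?mulN1r.
Qed.

Lemma fcoef_euler_kernel_power lambda r m :
  fcoef (2%:R ^+ r * dexp lambda r%:R / (dexp lambda 1 + 1) ^+ r) m
  = \sum_(l < r.+1)
      'C(r, l)%:R * (-1) ^+ l * 2%:R ^+ (r - l) * deuler lambda l m 0 / m`!%:R.
Proof.
rewrite euler_kernel_power fcoef_sum; apply: eq_bigr => l _.
rewrite fcoefMn fcoef_signed_pow2 /deuler dexp0 mulr1 -mulr_natl.
by have := natr_fact_neq0 R m; move=> ?; field.
Qed.

(** The last entry N of a chain is positive, so N! / (N-1)! = N, which is
    absorbed by the last power. *)
Lemma chain_weight_fact lambda r (k : r.-tuple int) N (ns : r.-tuple 'I_N.+1) :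
    (0 < r)%N -> chain ns ->
  chain_weight lambda k ns * (ent ns r.-1)`!%:R
  = (\prod_(i < r) dfalling lambda 1 (ent ns i))
    / ((\prod_(0 <= i < r.-1) ((ent ns i).-1)`!%:R)
       * (\prod_(0 <= i < r.-1) (ent ns i)%:R ^ nth 0 k i)
       * (ent ns r.-1)%:R ^ (nth 0 k r.-1 - 1)).
Proof.
case: r k ns => // r k ns _ chn; rewrite /chain_weight [r.+1.-1]/=.
set D := \prod_(i < r.+1) dfalling _ _ _.
under [X in _ / (_ * X)]eq_bigr do rewrite (tnth_nth 0).
rewrite [X in _ / (X * _)]big_ord_recr [X in _ / (_ * X)]big_ord_recr !big_mkord /=.
have : (0 < ent ns r)%N by apply: leq_ltn_trans (chain_gt chn (ltnSn r)).
have P0 : \prod_(i < r) ((ent ns i).-1)`!%:R != 0 :> R.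
  by apply/prodf_neq0 => i _; exact: natr_fact_neq0.
have Q0 : \prod_(i < r) (ent ns i)%:R ^ nth 0 k i != 0 :> R.
  apply/prodf_neq0 => i _; apply: expfz_neq0; rewrite pnatr_eq0 -lt0n.
  by apply: leq_ltn_trans (chain_gt chn _) => //; apply: ltnW; rewrite ltnS ltn_ord.
case: (ent ns r) => // a _; have a1 : a.+1%:R != 0 :> R by rewrite pnatr_eq0.
have := natr_fact_neq0 R a; have : a.+1%:R ^ nth 0 k r != 0 :> R by apply: expfz_neq0.
rewrite expfzDr // exprN1 factS natrM /= => ? ?; field.
by rewrite nat1r; do ?[apply/andP; split].
Qed.

End Final.

Theorem theorem2p3 (R : realType) (lambda : R) (n r : nat)
    (n_gt0 : (0 < n)%N) (r_gt0 : (0 < r)%N) (le_rn : (r <= n)%N)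
    (k : r.-tuple int) :
  dgenocchi lambda k n r%:R =
  \sum_(0 <= m < (n - r).+1) \sum_(0 <= l < r.+1)
    \sum_(ns : r.-tuple 'I_(n - m).+1 | chain ns)
      ((\prod_(i < r) dfalling lambda 1 (ent ns i))
       * 'C(r, l)%:R * 'C(n, m)%:R * (-1) ^+ l * 2%:R ^+ (r - l)
       * deuler lambda l m 0 * dstirling1 lambda (n - m) (ent ns r.-1))
      / ((\prod_(0 <= i < r.-1) ((ent ns i).-1)`!%:R)
         * (\prod_(0 <= i < r.-1) (ent ns i)%:R ^ nth 0 k i)
         * (ent ns r.-1)%:R ^ (nth 0 k r.-1 - 1)).
Proof.
pose A := 2%:R ^+ r * dexp lambda r%:R / (dexp lambda 1 + 1) ^+ r.
pose B := fps_comp (dEi lambda k) (dlog1p lambda).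
have BE M : fcoef B M = \sum_(ns : r.-tuple 'I_M.+1 | chain ns)
    chain_weight lambda k ns * (ent ns r.-1)`!%:R
      * dstirling1 lambda M (ent ns r.-1) / M`!%:R.
  rewrite fps_comp_dEi //; apply: eq_bigr => ns _.
  rewrite (dstirling1_uniq (dstirling1P lambda) (dlog1p_stirling1 lambda)).
    have M0 := natr_fact_neq0 R M; have e0 := natr_fact_neq0 R (ent ns r.-1).
    by field; rewrite M0.
  by rewrite -ltnS ent_ltn.
have B0 M : (M < r)%N -> fcoef B M = 0.
  move=> lt_Mr; rewrite BE big1 // => ns chn.
  have := chain_gt (i := r.-1) chn; rewrite prednK // => /(_ (leqnn r)).
  by rewrite leqNgt (leq_ltn_trans _ lt_Mr) // -ltnS ent_ltn.
have -> : dgenocchi lambda k n r%:R = n`!%:R * fcoef (A * B) n.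
  by rewrite /dgenocchi -/B; congr (_ * fcoef _ _); rewrite /A; ring.
rewrite fcoefM -(big_mkord xpredT (fun m => fcoef A m * fcoef B (n - m))).
(* The terms with m > n - r vanish: no chain of length r fits below r. *)
rewrite (@big_cat_nat _ _ _ (n - r).+1) ?ltnS ?leq_subr //.
rewrite [X in _ * (_ + X)]big_nat [X in _ * (_ + X)]big1 ?addr0;
  last by move=> m /andP[lt_m le_m]; rewrite B0 ?mulr0 // ltn_subLR // addnC
    -ltn_subLR.
rewrite mulr_sumr big_nat [RHS]big_nat; apply: eq_bigr => m /andP[_ le_m].
have le_mn : (m <= n)%N by rewrite (leq_trans _ (leq_subr r n)).
rewrite fcoef_euler_kernel_power BE big_mkord mulrCA mulr_suml.
apply: eq_bigr => l _; rewrite !mulr_sumr; apply: eq_bigr => ns chn.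
rewrite chain_weight_fact //; set W := (X in _ = _ / X).
rewrite -(bin_fact le_mn) !natrM.
have M0 := natr_fact_neq0 R m; have N0 := natr_fact_neq0 R (n - m).
move: W^-1 => V.
by field; rewrite N0.
Qed.
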